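(* Let $R = \{(x;y;z) : x,y,z \in \mathbb{R}^3,\ \sum_i x_i = \sum_i y_i = \sum_i z_i = 0\} \subset \mathbb{R}^9$ (a 6-dimensional Euclidean space), and write $[x;y;z] \in \mathbb{P}(R)$ for the line spanned by a non-zero vector $(x;y;z) \in R$. Let the wreath product $S_3 \wr S_3$ act on $\mathbb{P}(R)$ by permuting the three coordinates within each of the blocks $x$, $y$, $z$ separately and by permuting the three blocks $x,y,z$; let $(\mathbb{Z}/2\mathbb{Z})^3$ act on $\mathbb{P}(R)$ by changing the signs of the blocks $x$, $y$, $z$ separately. For $\lambda \in \mathbb{P}(R)$ let $O(\lambda)$ be its orbit under $S_3 \wr S_3$, and let $\widehat{O}(\lambda)$ be its orbit under the free product of $S_3 \wr S_3$ and $(\mathbb{Z}/2\mathbb{Z})^3$ (equivalently, under the group of transformations generated by the two actions). Put \begin{align*} \lambda_1 &= [1,-1,0;\ 0,0,0;\ 0,0,0], & \lambda_2 &= [2,-1,-1;\ 2,-1,-1;\ 2,-1,-1],\\ \lambda_3 &= [1,-1,0;\ 1,-1,0;\ 0,0,0], & \lambda_4 &= [2,-1,-1;\ -2,1,1;\ 0,0,0],\\ \lambda_5 &= [-4,2,2;\ 2,-1,-1;\ 2,-1,-1], & \lambda_6 &= [2,-1,-1;\ 0,0,0;\ 0,0,0]. \end{align*} Then: (1) $A := O(\lambda_1) \cup O(\lambda_2)$ is the $E_6$ projective configuration (the set of lines spanned by the roots of the root system $E_6$ in $R$). (2) $\widetilde{A} := \bigcup_{i=1}^{5} O(\lambda_i)$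 is a saturated projective configuration, $\widetilde{A} \supset A$, $|\widetilde{A}| = 198$. It admits precisely one good bicolouring, and the set of red lines (those with value $1$) of this bicolouring is the orbit $O(\lambda_4)$. (3) $\widehat{A} := \bigcup_{i=1}^{6} \widehat{O}(\lambda_i)$ is a saturated non-colourable projective configuration, $\widehat{A} \supset \widetilde{A} \supset A$, and $|\widehat{A}| = 558$.
   Context: Let $\mathcal{H}$ be a real inner product space of finite dimension $d$ (here $\mathcal{H} = R$ with the inner product inherited from $\mathbb{R}^9$, so $d = 6$), let $\mathbb{P}(\mathcal{H})$ be the set of its one-dimensional subspaces (lines), with the orthogonality relation $\perp$ between lines, and let $A \subset \mathbb{P}(\mathcal{H})$ be a finite set (a ''projective configuration''). Colourability. A bicolouring $v : A \to \{0,1\}$ ($1$ = red, $0$ = blue) is good if (i) for every collection of $d$ mutually orthogonal lines $x_1, \dots, x_d \in A$ there is a unique $i_0$ with $v(x_{i_0}) = 1$; and (ii) for all $x, y \in A$, if $y \perp x$ and $v(x) = 1$, then $v(y) = 0$. $A$ is colourable if it admits a good bicolouring, and non-colourable otherwise. Saturation. $A$ is saturated if every set $U \subset A$ of pairwise orthogonal lines is contained in some set $M \subset A$ consisting of exactly $d$ pairwise orthogonal lines. The $E_6$ root system in $R$. It has 72 elements: the vectors $(\xi;0;0)$, $(0;\xi;0)$, $(0;0;\xi)$ with $\xi \in \{(1,-1,0),(1,0,-1),(0,1,-1)\}$, the vectors $(\xi;\eta;\zeta)$ with $\xi,\eta,\zeta \in \{\frac13(2,-1,-1),\frac13(-1,2,-1),\frac13(-1,-1,2)\}$,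 and the negatives of all these; it spans 36 lines. *)

(* Defs.v *)
(* MathComp / MathComp-Analysis; the reals are an arbitrary R : realType. *)
From HB Require Import structures.
From mathcomp Require Import all_boot all_order all_algebra all_fingroup.
From mathcomp Require Import boolp classical_sets cardinality reals.

Set Implicit Arguments.
Unset Strict Implicit.
Unset Printing Implicit Defensive.

Import Order.TTheory GRing.Theory Num.Theory.
Local Open Scope classical_set_scope.
Local Open Scope card_scope.
Local Open Scope ring_scope.

(* The ambient inner product space is a subspace H of V with the restriction
   of the inner product dot of V; lines are subspaces of V. *)
Section Configurations.
Variables (R : realType) (V : vectType R) (dot : V -> V -> R) (H : {vspace V}).

Definition projective : set {vspace V} :=
  [set L : {vspace V} | (L <= H)%VS /\ \dim L = 1%N].

Definition orthogonal_lines (L M : {vspace V}) : Prop :=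
  forall u v, u \in L -> v \in M -> dot u v = 0.

Definition projective_configuration (A : set {vspace V}) : Prop :=
  finite_set A /\ A `<=` projective.

Definition pairwise_orthogonal_lines (U : set {vspace V}) : Prop :=
  forall L M, U L -> U M -> L <> M -> orthogonal_lines L M.

Definition saturated (A : set {vspace V}) : Prop :=
  forall U, U `<=` A -> pairwise_orthogonal_lines U ->
  exists M, [/\ U `<=` M, M `<=` A, M #= `I_(\dim H)
              & pairwise_orthogonal_lines M].

(* true stands for 1 (red), false for 0 (blue). *)
Definition good_bicolouring (A : set {vspace V}) (v : A -> bool) : Prop :=
  (forall x : 'I_(\dim H) -> A,
     (forall i j, i != j -> orthogonal_lines (val (x i)) (val (x j))) ->
     exists! i0, v (x i0) = true)
  /\ (forall x y : A,
        orthogonal_lines (val y) (val x) -> v x = true -> v y = false).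

Definition colourable (A : set {vspace V}) : Prop :=
  exists v : A -> bool, good_bicolouring v.

Definition red_lines (A : set {vspace V}) (v : A -> bool) : set {vspace V} :=
  [set val x | x in [set x : A | v x = true]].

End Configurations.

(* R^9 = (R^3)^3 is the space of 3 x 3 matrices: row i is the i-th block. *)
Section NineSpace.
Variable R : realType.

Definition dot9 (u v : 'M[R]_3) : R := \sum_i \sum_j u i j * v i j.

(* The entries of u *m const_mx 1 are the sums of the three blocks of u. *)
Definition block_sum0 : {vspace 'M[R]_3} :=
  lker (linfun (mulmxr (const_mx 1 : 'cV[R]_3) : 'M[R]_3 -> 'cV[R]_3)).

Fact dim_block_sum0 : \dim block_sum0 = 6%N.
Proof.
rewrite /block_sum0; set f := linfun _.
have im : (limg f = fullv)%VS.
  apply/eqP; rewrite eqEsubv subvf /=; apply/subvP=> w _.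
  apply/memv_imgP; exists (\matrix_(i, j) (w i 0 *+ (j == 0))); first exact: memvf.
  rewrite lfunE /=; apply/matrixP=> i j; rewrite !mxE ord1 (bigD1 0) //= !mxE mulr1.
  by rewrite big1 ?addr0 // => k /negPf nk; rewrite !mxE nk mul0r.
have := limg_ker_dim f fullv; rewrite capfv im !dimvf /dim /= => e.
by apply/eqP; rewrite -(eqn_add2r 3) e.
Qed.

Definition vec3 (a b c : R) : 'rV[R]_3 := \row_j [:: a; b; c]`_j.

Definition blocks (x y z : 'rV[R]_3) : 'M[R]_3 := \matrix_i [:: x; y; z]`_i.

Definition line (x y z : 'rV[R]_3) : {vspace 'M[R]_3} := <[blocks x y z]>%VS.

(* An element (s, t) of the wreath product consists of a permutation s i of
   the coordinates of each block i and a permutation t of the blocks. *)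
Definition wreath : Type := ({ffun 'I_3 -> 'S_3} * 'S_3)%type.

Definition wreath_vec (g : wreath) (u : 'M[R]_3) : 'M[R]_3 :=
  \matrix_(i, j) u (g.2 i) (g.1 i j).

Definition signs : Type := {ffun 'I_3 -> 'Z_2}.

Definition signs_vec (e : signs) (u : 'M[R]_3) : 'M[R]_3 :=
  \matrix_(i, j) ((-1) ^+ (e i) * u i j).

Fact wreath_vec_is_linear g : linear (wreath_vec g).
Proof. by move=> a u v; apply/matrixP=> i j; rewrite !mxE. Qed.

HB.instance Definition _ g :=
  GRing.isLinear.Build R 'M[R]_3 'M[R]_3 _ (wreath_vec g)
    (wreath_vec_is_linear g).

Fact signs_vec_is_linear e : linear (signs_vec e).
Proof.
by move=> a u v; apply/matrixP=> i j; rewrite !mxE mulrDr mulrCA.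
Qed.

HB.instance Definition _ e :=
  GRing.isLinear.Build R 'M[R]_3 'M[R]_3 _ (signs_vec e)
    (signs_vec_is_linear e).

Definition wreath_act (g : wreath) (L : {vspace 'M[R]_3}) : {vspace 'M[R]_3} :=
  (linfun (wreath_vec g) @: L)%VS.

Definition signs_act (e : signs) (L : {vspace 'M[R]_3}) : {vspace 'M[R]_3} :=
  (linfun (signs_vec e) @: L)%VS.

Definition O (L : {vspace 'M[R]_3}) : set {vspace 'M[R]_3} :=
  range (fun g : wreath => wreath_act g L).

Definition letter_act (a : wreath + signs) (L : {vspace 'M[R]_3}) :
    {vspace 'M[R]_3} :=
  match a with inl g => wreath_act g L | inr e => signs_act e L end.

(* Elements of the free product are represented by words in the elements of
   its two factors. *)
Definition Ohat (L : {vspace 'M[R]_3}) : set {vspace 'M[R]_3} :=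
  range (fun w : seq (wreath + signs) => foldr letter_act L w).

Definition lambda1 := line (vec3 1 (-1) 0) 0 0.
Definition lambda2 :=
  line (vec3 2 (-1) (-1)) (vec3 2 (-1) (-1)) (vec3 2 (-1) (-1)).
Definition lambda3 := line (vec3 1 (-1) 0) (vec3 1 (-1) 0) 0.
Definition lambda4 := line (vec3 2 (-1) (-1)) (vec3 (-2) 1 1) 0.
Definition lambda5 :=
  line (vec3 (-4) 2 2) (vec3 2 (-1) (-1)) (vec3 2 (-1) (-1)).
Definition lambda6 := line (vec3 2 (-1) (-1)) 0 0.

Definition E6_single : set 'rV[R]_3 :=
  [set` [:: vec3 1 (-1) 0; vec3 1 0 (-1); vec3 0 1 (-1)]].

Definition E6_third : set 'rV[R]_3 :=
  [set` [:: 3^-1 *: vec3 2 (-1) (-1); 3^-1 *: vec3 (-1) 2 (-1);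
            3^-1 *: vec3 (-1) (-1) 2]].

Definition E6_half : set 'M[R]_3 :=
  [set u : 'M[R]_3 |
    (exists2 xi, E6_single xi &
       [\/ u = blocks xi 0 0, u = blocks 0 xi 0 | u = blocks 0 0 xi])
    \/ (exists xi eta zeta, [/\ E6_third xi, E6_third eta, E6_third zeta
                              & u = blocks xi eta zeta])].

Definition E6_roots : set 'M[R]_3 :=
  [set u : 'M[R]_3 | E6_half u \/ E6_half (- u)].

Definition E6_configuration : set {vspace 'M[R]_3} :=
  [set <[u]>%VS | u in E6_roots].

Definition A_E6 : set {vspace 'M[R]_3} := O lambda1 `|` O lambda2.

Definition Atilde : set {vspace 'M[R]_3} :=
  O lambda1 `|` O lambda2 `|` O lambda3 `|` O lambda4 `|` O lambda5.

Definition Ahat : set {vspace 'M[R]_3} :=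
  Ohat lambda1 `|` Ohat lambda2 `|` Ohat lambda3 `|` Ohat lambda4
  `|` Ohat lambda5 `|` Ohat lambda6.

End NineSpace.

Arguments lambda1 {R}.
Arguments lambda2 {R}.
Arguments lambda3 {R}.
Arguments lambda4 {R}.
Arguments lambda5 {R}.
Arguments lambda6 {R}.
Arguments E6_configuration R : clear implicits.
Arguments A_E6 R : clear implicits.
Arguments Atilde R : clear implicits.
Arguments Ahat R : clear implicits.

(* Main.v *)
(* Every line occurring here is spanned by an integer vector, so orthogonality
   and membership in the orbits are decided by integer computation. Since the
   configurations are invariant under the group, saturation only has to be
   checked for the cliques of the orthogonality graph through one representative
   of each orbit: all maximal ones have six elements, and in the 198-line
   configuration each of them meets O(lambda_4).
   In a good bicolouring of the 198 lines, a short case analysis over bases shows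
   that no line of O(lambda_2), then none of O(lambda_1), O(lambda_3) and
   O(lambda_5), is red. Hence red lines lie in O(lambda_4), and as each line lies
   in a basis while no two lines of O(lambda_4) are orthogonal, the red lines are
   exactly O(lambda_4). A good bicolouring of the 558 lines restricts to the
   198 lines, and so does its transform by a sign change; hence both lambda_4
   and its image [-2,1,1; -2,1,1; 0,0,0] would be red, but they are orthogonal. *)
Require Import Defs.
From Stdlib Require Import ZArith.
From mathcomp Require Import all_boot all_order all_algebra all_fingroup.
From mathcomp Require Import finmap boolp classical_sets cardinality reals.
From mathcomp Require Import ssrZ.

Local Open Scope classical_set_scope.
Local Open Scope card_scope.

Set Implicit Arguments.
Unset Strict Implicit.
Unset Printing Implicit Defensive.

(** * Integer codes of lines *)

Section Codes.
Local Open Scope Z_scope.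

Definition code := seq (seq Z).

Definition dot_row (x y : seq Z) : Z :=
  foldr Z.add 0 [seq p.1 * p.2 | p <- zip x y].
Definition dot_code (c d : code) : Z :=
  foldr Z.add 0 [seq dot_row p.1 p.2 | p <- zip c d].
Definition orth (c d : code) : bool := dot_code c d =? 0.

Definition lead (s : seq Z) : Z := head 0 [seq x <- s | ~~ (x =? 0)].

(* The first nonzero coefficient becomes 4 if it divides 4, as it does for all
   codes used below, so that equal lines get equal codes. *)
Definition normalise (c : code) : code :=
  let k := Z.quot 4 (lead (flatten c)) in
  if k =? 0 then c else map (map (Z.mul k)) c.

Definition row_perms (d : code) : seq code :=
  foldr (fun x r => [seq y :: b | y <- permutations x, b <- r]) [:: [::]] d.
(** Blocks are permuted first and the entries inside each block afterwards; normalising before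
    [undup] merges opposite vectors. *)
Definition orbit_code (c : code) : seq code :=
  undup [seq normalise b | d <- permutations c, b <- row_perms d].

Definition sign_changes (d : code) : seq code :=
  foldr (fun x r => [seq y :: b | y <- [:: x; map Z.opp x], b <- r]) [:: [::]] d.
(** One sign change after the wreath orbit is enough, because the wreath product normalises the
    group of sign changes ([wreath_signs_act]). *)
Definition orbit_hat_code (c : code) : seq code :=
  undup [seq normalise b | d <- orbit_code c, b <- sign_changes d].

Definition shaped (c : code) : bool :=
  (size c == 3)%nat && all (fun x => size x == 3)%nat c.

(** The leading 4 makes the spanning vector of a line unique, the zero row sums put the line in $R$,
    and the last clause keeps it from being orthogonal to itself. *)
Definition code_ok (c : code) : bool :=
  [&& shaped c, lead (flatten c) =? 4, all (fun x => foldr Z.add 0 x =? 0) c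
    & ~~ orth c c].

Definition code1 : code := [:: [:: 1; -1; 0]; [:: 0; 0; 0]; [:: 0; 0; 0]].
Definition code2 : code := [:: [:: 2; -1; -1]; [:: 2; -1; -1]; [:: 2; -1; -1]].
Definition code3 : code := [:: [:: 1; -1; 0]; [:: 1; -1; 0]; [:: 0; 0; 0]].
Definition code4 : code := [:: [:: 2; -1; -1]; [:: -2; 1; 1]; [:: 0; 0; 0]].
Definition code5 : code := [:: [:: -4; 2; 2]; [:: 2; -1; -1]; [:: 2; -1; -1]].
Definition code6 : code := [:: [:: 2; -1; -1]; [:: 0; 0; 0]; [:: 0; 0; 0]].
Definition code4_flip : code :=
  [:: [:: -2; 1; 1]; [:: -2; 1; 1]; [:: 0; 0; 0]].

Definition single_rows : seq (seq Z) :=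
  [:: [:: 1; -1; 0]; [:: 1; 0; -1]; [:: 0; 1; -1]].
(** Three times the vectors of [E6_third]; the factor does not affect the lines. *)
Definition third_rows : seq (seq Z) :=
  [:: [:: 2; -1; -1]; [:: -1; 2; -1]; [:: -1; -1; 2]].

End Codes.

Definition reps_tilde := [:: code1; code2; code3; code4; code5].
Definition reps_hat := rcons reps_tilde code6.
Definition Atilde_codes : seq code := flatten (map orbit_code reps_tilde).
Definition Ahat_codes : seq code := flatten (map orbit_hat_code reps_hat).

Import Order.TTheory GRing.Theory Num.Theory.
Local Open Scope ring_scope.

(** * Rearrangements of three-element lists as elements of $S_3$ *)

Section PermutedSequences.
Variables (T : eqType) (x0 : T).
Implicit Types b d : seq T.

Lemma perm_nth_ord d (s : 'S_3) :
  size d = 3%N -> perm_eq [seq nth x0 d (s i) | i <- enum 'I_3] d.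
Proof.
move=> /eqP sz; apply/(@tuple_permP _ _ _ (Tuple sz)); exists s => /=.
by apply: eq_map => i; rewrite (tnth_nth x0).
Qed.

Lemma perm_eq_ord d b : size d = 3%N -> perm_eq b d ->
  exists s : 'S_3, b = [seq nth x0 d (s i) | i <- enum 'I_3].
Proof.
move=> /eqP sz /(@tuple_permP _ _ _ (Tuple sz))[s ->]; exists s => /=.
by apply: eq_map => i; rewrite (tnth_nth x0).
Qed.

End PermutedSequences.

Lemma mem_row_perms b d : (b \in row_perms d) = all2 perm_eq b d.
Proof.
elim: d b => [|x d IH] [|y b] //=.
  by apply/negbTE/negP => /allpairsP[[? ?] []].
rewrite -IH; apply/allpairsP/andP => [[[y' b'] /= [hy hb [-> ->]]]|[hy hb]].
  by rewrite -mem_permutations.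
by exists (y, b); rewrite mem_permutations.
Qed.

Lemma mem_sign_changes b d : (b \in sign_changes d) =
  all2 (fun y x => (y == x) || (y == map Z.opp x)) b d.
Proof.
elim: d b => [|x d IH] [|y b] //.
  by apply/negbTE/negP => /allpairsP[[? ?] []].
rewrite [RHS]/= -IH -(mem_seq2 y x).
rewrite -[sign_changes _]/(allpairs cons [:: x; map Z.opp x] (sign_changes d)).
apply/allpairsP/andP => [[[y' b'] /= [hy hb [-> ->]]] //|[hy hb]].
by exists (y, b).
Qed.

(** * Lines spanned by integer codes *)

Section Lines.
Variable R : realType.
Local Notation vspaceM := {vspace 'M[R]_3}.

(** Binary integers keep the enumerations computable; as this map is an injective ring morphism, a
    dot product vanishes over the reals exactly when it vanishes in [Z]. *)
Definition Zreal (z : Z) : R := (int_of_Z z)%:~R.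

Lemma Zreal0 : Zreal Z0 = 0. Proof. by []. Qed.
Lemma ZrealD x y : Zreal (Z.add x y) = Zreal x + Zreal y.
Proof. by rewrite /Zreal (rmorphD int_of_Z x y) intrD. Qed.
Lemma ZrealM x y : Zreal (Z.mul x y) = Zreal x * Zreal y.
Proof. by rewrite /Zreal (rmorphM int_of_Z x y) intrM. Qed.
Lemma ZrealN x : Zreal (Z.opp x) = - Zreal x.
Proof. by rewrite /Zreal (rmorphN int_of_Z x) intrN. Qed.
Lemma Zreal_inj : injective Zreal.
Proof. by move=> x y /intr_inj/(can_inj int_of_ZK). Qed.
Lemma Zreal_eq0 x : (Zreal x == 0) = Z.eqb x Z0.
Proof. by rewrite -Zreal0 (inj_eq Zreal_inj). Qed.

Definition code_mx (c : code) : 'M[R]_3 :=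
  \matrix_(i, j) Zreal (nth Z0 (nth [::] c i) j).

Definition cline (c : code) : vspaceM := <[code_mx c]>%VS.

Lemma shapedP c : shaped c ->
  exists a0 a1 a2 b0 b1 b2 c0 c1 c2,
    c = [:: [:: a0; a1; a2]; [:: b0; b1; b2]; [:: c0; c1; c2]].
Proof.
case: c => [|x [|y [|z []]]] //= /and4P[].
case: x => [|a0 [|a1 [|a2 []]]] //; case: y => [|b0 [|b1 [|b2 []]]] //.
case: z => [|c0 [|c1 [|c2 []]]] // _ _ _ _.
by exists a0, a1, a2, b0, b1, b2, c0, c1, c2.
Qed.

Lemma dot9_code c d : shaped c -> shaped d ->
  dot9 (code_mx c) (code_mx d) = Zreal (dot_code c d).
Proof.
move=> /shapedP[a0 [a1 [a2 [b0 [b1 [b2 [c0 [c1 [c2 ->]]]]]]]]].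
move=> /shapedP[a3 [a4 [a5 [b3 [b4 [b5 [c3 [c4 [c5 ->]]]]]]]]].
by rewrite /dot9 !big_ord_recl !big_ord0 !mxE /= !(ZrealD, ZrealM).
Qed.

Local Notation orthL := (@orthogonal_lines R 'M[R]_3 (@dot9 R)).

Lemma dot9Z a b (u v : 'M[R]_3) : dot9 (a *: u) (b *: v) = a * b * dot9 u v.
Proof.
rewrite /dot9 mulr_sumr; apply: eq_bigr => i _; rewrite mulr_sumr.
by apply: eq_bigr => j _; rewrite !mxE mulrACA.
Qed.

Lemma dot9C (u v : 'M[R]_3) : dot9 u v = dot9 v u.
Proof. by do 2![apply: eq_bigr => ? _]; rewrite mulrC. Qed.

Lemma orth_sym L M : orthL L M -> orthL M L.
Proof. by move=> h u v hu hv; rewrite dot9C h. Qed.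

Lemma orth_clineP c d : shaped c -> shaped d -> orthL (cline c) (cline d) <-> orth c d.
Proof.
move=> sc sd; rewrite /orth -Zreal_eq0 -dot9_code //; split=> [h|/eqP h u v].
  by apply/eqP/h; exact: memv_line.
by move=> /vlineP[a ->] /vlineP[b ->]; rewrite dot9Z h mulr0.
Qed.

Lemma vline_scale (k : R) (u : 'M[R]_3) : k != 0 -> <[k *: u]>%VS = <[u]>%VS.
Proof.
move=> k0; apply/eqP; rewrite eqEsubv -!memvE memvZ ?memv_line //=.
by rewrite -{1}[u](scalerK k0) memvZ ?memv_line.
Qed.

Lemma cline_scale k c : k != Z0 -> cline (map (map (Z.mul k)) c) = cline c.
Proof.
(* Entries out of range default to 0, and this default must be compatible with scaling. *)
move=> k0; have kz : Z.mul k Z0 = Z0 by case: (k).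
have k0' : Zreal k != 0 by rewrite Zreal_eq0.
rewrite -[RHS](vline_scale _ k0'); congr <[_]>%VS; apply/matrixP => i j.
rewrite !mxE -ZrealM; case: (ltnP i (size c)) => hi; last first.
  by rewrite !(nth_default [::]) ?size_map // nth_nil kz.
rewrite (nth_map [::]) //; case: (ltnP j (size (nth [::] c i))) => hj.
  by rewrite (nth_map Z0).
by rewrite !(nth_default Z0) ?size_map // kz.
Qed.

Lemma cline_normalise c : cline (normalise c) = cline c.
Proof.
by rewrite /normalise; case: ifP => // /negbT h; rewrite cline_scale.
Qed.

(** A nonzero factor preserves the positions of the zeros, so both leading entries stand at the same
    position. *)
Lemma lead_scale (k : R) (s t : seq Z) : k != 0 -> size s = size t ->
  (forall i, Zreal (nth Z0 t i) = k * Zreal (nth Z0 s i)) ->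
  Zreal (lead t) = k * Zreal (lead s).
Proof.
move=> k0; elim: s t => [|x s IH] [|y t] //; first by rewrite mulr0.
move=> [st] h.
have := h 0%N; rewrite /lead /= => hxy.
have -> : Z.eqb y Z0 = Z.eqb x Z0.
  by rewrite -!Zreal_eq0 hxy mulf_eq0 (negPf k0).
case: ifP => //= _; apply: IH => // i; exact: (h i.+1).
Qed.

Lemma cline_neq0 c : code_ok c -> code_mx c != 0.
Proof.
case/and4P=> sc _ _; rewrite /orth -Zreal_eq0 -dot9_code //.
by apply: contraNneq => ->; rewrite -[X in dot9 X](scale0r 0) -[X in dot9 _ X](scale0r 0) dot9Z !mul0r.
Qed.

Lemma flatten_code_mx c i j : shaped c -> (i < 3)%N -> (j < 3)%N ->
  nth Z0 (flatten c) (i * 3 + j) = nth Z0 (nth [::] c i) j.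
Proof.
move=> /shapedP[a0 [a1 [a2 [b0 [b1 [b2 [c0 [c1 [c2 ->]]]]]]]]].
by case: i => [|[|[|]]] //; case: j => [|[|[|]]].
Qed.

Lemma size_flatten_shaped c : shaped c -> size (flatten c) = 9%N.
Proof. by move=> /shapedP[a0 [a1 [a2 [b0 [b1 [b2 [c0 [c1 [c2 ->]]]]]]]]]. Qed.

(** Two spanning vectors of one line are proportional, and the factor is 1 because both leading
    entries are 4. *)
Lemma cline_inj : {in code_ok &, injective cline}.
Proof.
move=> c d okc okd e; have d0 := cline_neq0 okd.
have /vlineP[k ek] : code_mx d \in cline c by rewrite e memv_line.
have k0 : k != 0 by apply: contraNneq d0 => k0; rewrite ek k0 scale0r.
case/and4P: okc => sc /Z.eqb_spec lc _ _; case/and4P: okd => sd /Z.eqb_spec ld _ _.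
have entry p : Zreal (nth Z0 (flatten d) p) = k * Zreal (nth Z0 (flatten c) p).
  case: (ltnP p 9) => [hp|hp]; last first.
    by rewrite !nth_default ?size_flatten_shaped // mulr0.
  (* Position [p] of a flattened code is the entry in row [p %/ 3] and column [p %% 3]. *)
  rewrite (divn_eq p 3) !flatten_code_mx ?ltn_mod ?ltn_divLR //.
  have h3 : (p %/ 3 < 3)%N by rewrite ltn_divLR.
  have m3 : (p %% 3 < 3)%N by rewrite ltn_mod.
  by move/matrixP: ek => /(_ (Ordinal h3) (Ordinal m3)); rewrite !mxE.
have := lead_scale k0 _ entry; rewrite !size_flatten_shaped // lc ld => /(_ erefl).
have nz4 : Zreal (Zpos 4) != 0 by rewrite Zreal_eq0.
rewrite -[LHS]mul1r => /(mulIf nz4) k1.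
have fe : flatten c = flatten d.
  apply: (@eq_from_nth _ Z0); first by rewrite !size_flatten_shaped.
  by move=> i _; apply: Zreal_inj; rewrite entry -k1 mul1r.
move: fe; case/shapedP: sc => [a0 [a1 [a2 [b0 [b1 [b2 [c0 [c1 [c2 ->]]]]]]]]].
case/shapedP: sd => [a3 [a4 [a5 [b3 [b4 [b5 [c3 [c4 [c5 ->]]]]]]]]].
by case=> -> -> -> -> -> -> -> -> ->.
Qed.

Lemma cline_projective c : code_ok c -> projective (block_sum0 R) (cline c).
Proof.
move=> ok; split; last by rewrite dim_vline cline_neq0.
case/and4P: ok => /shapedP[a0 [a1 [a2 [b0 [b1 [b2 [c0 [c1 [c2 ->]]]]]]]]] _ /=.
case/and4P=> /eqP ha /eqP hb /eqP hc _ _.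
rewrite -memvE memv_ker lfunE /=; apply/eqP/matrixP => i j.
rewrite !mxE !big_ord_recl big_ord0 !mxE !mulr1.
by case: i => [[|[|[|]]]] //= ?; rewrite -?Zreal0 -!ZrealD ?ha ?hb ?hc.
Qed.

End Lines.

(** * The group action *)

Section Actions.
Variable R : realType.
Local Notation vspaceM := {vspace 'M[R]_3}.
Local Notation orthL := (@orthogonal_lines R 'M[R]_3 (@dot9 R)).
Implicit Types (g h : wreath) (e f : signs) (L M : vspaceM).

(** This order of the factors makes [wreath_act] a left action: [wreath_vec] precomposes with the
    indices, and a product of permutations applies its left factor first. *)
Definition wreath_mul g h : wreath :=
  ([ffun i => (g.1 i * h.1 (g.2 i))%g], (g.2 * h.2)%g).
Definition wreath_inv g : wreath :=
  ([ffun i => ((g.1 (g.2^-1%g i))^-1)%g], (g.2^-1)%g).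
Definition signs_mul e f : signs := [ffun i => e i + f i].

Lemma wreath_actM g h L :
  wreath_act g (wreath_act h L) = wreath_act (wreath_mul g h) L.
Proof.
rewrite /wreath_act -limg_comp; congr (_ @: L)%VS; apply/lfunP => u.
rewrite comp_lfunE !lfunE /=; apply/matrixP => i j.
by rewrite !mxE /= !ffunE !permM.
Qed.

Lemma wreath_actK g : cancel (@wreath_act R g) (wreath_act (wreath_inv g)).
Proof.
move=> L; rewrite wreath_actM -[RHS]lim1g; congr (_ @: L)%VS; apply/lfunP => u.
rewrite !lfunE /=; apply/matrixP => i j.
by rewrite !mxE /= !ffunE !permM /= permKV -permM mulVg perm1.
Qed.

Lemma wreath_actKV g : cancel (wreath_act (wreath_inv g)) (@wreath_act R g).
Proof.
move=> L; rewrite wreath_actM -[RHS]lim1g; congr (_ @: L)%VS; apply/lfunP => u.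
rewrite !lfunE /=; apply/matrixP => i j.
by rewrite !mxE /= !ffunE !permM /= permK -permM mulgV perm1.
Qed.

Lemma Z2_cases (a : 'Z_2) : a = 0 \/ a = 1.
Proof. by case: a => [[|[|m]] hm] //; [left|right]; exact: val_inj. Qed.

Lemma signr_Z2D (a b : 'Z_2) : (-1) ^+ (a + b)%R = (-1) ^+ a * (-1) ^+ b :> R.
Proof.
by case: (Z2_cases a) => ->; case: (Z2_cases b) => ->;
  rewrite /= ?expr0 ?expr1 ?mulr1 ?mul1r ?mulrNN ?mulr1.
Qed.

Lemma signs_actM e f L :
  signs_act e (signs_act f L) = signs_act (signs_mul e f) L.
Proof.
rewrite /signs_act -limg_comp; congr (_ @: L)%VS; apply/lfunP => u.
rewrite comp_lfunE !lfunE /=; apply/matrixP => i j.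
by rewrite !mxE !ffunE signr_Z2D mulrA.
Qed.

Lemma signs_actK e : involutive (@signs_act R e).
Proof.
move=> L; rewrite signs_actM -[RHS]lim1g; congr (_ @: L)%VS; apply/lfunP => u.
rewrite !lfunE /=; apply/matrixP => i j.
by rewrite !mxE !ffunE signr_Z2D -expr2 sqrr_sign mul1r.
Qed.

(** Moving a sign change across a wreath element only permutes its three signs, so signs can be
    collected on the left. *)
Lemma wreath_signs_act g e L : wreath_act g (signs_act e L) =
  signs_act [ffun i => e (g.2 i)] (wreath_act g L).
Proof.
rewrite /signs_act /wreath_act -!limg_comp; congr (_ @: L)%VS; apply/lfunP => u.
rewrite !comp_lfunE !lfunE /=; apply/matrixP => i j.
by rewrite !mxE /= !ffunE.
Qed.

Lemma signs_act_id L : signs_act [ffun=> 0] L = L.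
Proof.
rewrite -[RHS]lim1g; congr (_ @: L)%VS; apply/lfunP => u.
by rewrite !lfunE /=; apply/matrixP => i j; rewrite !mxE !ffunE expr0 mul1r.
Qed.

Lemma wreath_act_id L : wreath_act ([ffun=> 1%g], 1%g) L = L.
Proof.
rewrite -[RHS]lim1g; congr (_ @: L)%VS; apply/lfunP => u.
by rewrite !lfunE /=; apply/matrixP => i j; rewrite !mxE /= !ffunE !perm1.
Qed.

Lemma orth_wreath g L M : orthL L M -> orthL (wreath_act g L) (wreath_act g M).
Proof.
move=> h _ _ /memv_imgP[u hu ->] /memv_imgP[v hv ->]; rewrite !lfunE /=.
rewrite -(h u v hu hv) /dot9 [RHS](reindex_inj (@perm_inj _ g.2)).
apply: eq_bigr => i _; rewrite [RHS](reindex_inj (@perm_inj _ (g.1 i))).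
by apply: eq_bigr => j _; rewrite !mxE.
Qed.

Lemma orth_signs e L M : orthL L M -> orthL (signs_act e L) (signs_act e M).
Proof.
move=> h _ _ /memv_imgP[u hu ->] /memv_imgP[v hv ->]; rewrite !lfunE /=.
rewrite -(h u v hu hv) /dot9.
apply: eq_bigr => i _; apply: eq_bigr => j _.
by rewrite !mxE mulrACA -expr2 sqrr_sign mul1r.
Qed.

(** Every word collapses to one wreath element followed by one sign change, so the infinite free
    product acts through a finite group. *)
Lemma OhatE L : Ohat L =
  [set signs_act p.1 (wreath_act p.2 L) | p in [set: signs * wreath]].
Proof.
apply/seteqP; split=> _ [w _ <-]; last first.
  by exists [:: inr w.1; inl w.2].
elim: w => [|[g|e] w [[f h] _ /= IH]] /=.
- by exists ([ffun=> 0], ([ffun=> 1%g], 1%g)); rewrite //= wreath_act_id signs_act_id.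
- by rewrite -IH wreath_signs_act wreath_actM; eexists (_, _).
- by rewrite -IH signs_actM; eexists (_, _).
Qed.

Definition wreath_code g (c : code) : code :=
  [seq [seq nth Z0 (nth [::] c (g.2 i)) (g.1 i j) | j <- enum 'I_3] | i <- enum 'I_3].

Lemma wreath_vec_code_mx g c : wreath_vec g (code_mx R c) = code_mx R (wreath_code g c).
Proof.
apply/matrixP => i j; rewrite !mxE (nth_map i) ?size_enum_ord // nth_ord_enum.
by rewrite (nth_map j) ?size_enum_ord // nth_ord_enum.
Qed.

Lemma wreath_act_cline g c : wreath_act g (cline R c) = cline R (wreath_code g c).
Proof. by rewrite /wreath_act limg_line lfunE /= wreath_vec_code_mx. Qed.

(** The rearranged list [d] determines the permutation of the blocks; each row of [b] then yields
    its own permutation of the coordinates. *)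
Lemma wreath_code_perms c b : shaped c ->
  (exists2 d, d \in permutations c & b \in row_perms d) <->
  (exists g, b = wreath_code g c).
Proof.
move=> sc; have szc : size c = 3%N by case/andP: sc => /eqP.
have szr i : (i < 3)%N -> size (nth [::] c i) = 3%N.
  by move=> hi; case/andP: sc => _ /all_nthP h; apply/eqP/h; rewrite szc.
split=> [[d]|[g ->]].
  rewrite mem_permutations mem_row_perms => /(perm_eq_ord [::] szc)[t dE].
  rewrite all2E dE size_map size_enum_ord => /andP[/eqP sb /all_nthP hb].
  have hb' (i : 'I_3) : exists s : 'S_3,
      nth [::] b i = [seq nth Z0 (nth [::] c (t i)) (s j) | j <- enum 'I_3].
    apply: perm_eq_ord; first exact: szr.
    have := hb ([::], [::]) i; rewrite size_zip size_map size_enum_ord sb /=.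
    rewrite nth_zip; last by rewrite size_map size_enum_ord.
    by rewrite (nth_map i) ?size_enum_ord // nth_ord_enum; apply.
  have [s hs] := fin_all_exists hb'; exists (finfun s, t).
  apply: (@eq_from_nth _ [::]); first by rewrite size_map size_enum_ord.
  rewrite sb => i hi; rewrite (nth_map ord0) ?size_enum_ord //.
  rewrite -[i]/(nat_of_ord (Ordinal hi)) nth_ord_enum hs.
  by apply: eq_map => j; rewrite ffunE.
exists [seq nth [::] c (g.2 i) | i <- enum 'I_3].
  by rewrite mem_permutations perm_nth_ord.
rewrite mem_row_perms all2E /wreath_code !size_map eqxx /= zip_map all_map.
apply/allP => i _ /=; apply: perm_nth_ord; exact: szr.
Qed.

(** This replaces an orbit of subspaces by a computable list. *)
Lemma O_cline c : shaped c -> O (cline R c) = cline R @` [set` orbit_code c].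
Proof.
move=> sc; apply/seteqP; split=> [_ [g _ <-]|_ [d hd <-]].
  rewrite wreath_act_cline -cline_normalise; exists (normalise (wreath_code g c)) => //=.
  rewrite mem_undup; have [_ /(_ (ex_intro _ g erefl)) [d hd hb]] := wreath_code_perms (wreath_code g c) sc.
  by apply/allpairsPdep; exists d, (wreath_code g c).
move: hd; rewrite /= mem_undup => /allpairsPdep[x [y [hx hy ->]]].
have [/(_ (ex_intro2 _ _ x hx hy))[g ->] _] := wreath_code_perms y sc.
by exists g; rewrite // wreath_act_cline cline_normalise.
Qed.

Definition signs_code e (c : code) : code :=
  [seq if e i == 0 then nth [::] c i else map Z.opp (nth [::] c i) | i <- enum 'I_3].

Lemma signs_act_cline e c : signs_act e (cline R c) = cline R (signs_code e c).
Proof.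
rewrite /signs_act limg_line lfunE /=; congr <[_]>%VS; apply/matrixP => i j.
rewrite !mxE (nth_map i) ?size_enum_ord // nth_ord_enum.
case: (Z2_cases (e i)) => -> /=; first by rewrite expr0 mul1r.
rewrite expr1 mulN1r -ZrealN; case: (ltnP j (size (nth [::] c i))) => hj.
  by rewrite (nth_map Z0).
by rewrite !(nth_default Z0) ?size_map.
Qed.

Lemma signs_code_changes c b : size c = 3%N ->
  (b \in sign_changes c) <-> (exists e, b = signs_code e c).
Proof.
move=> szc; have E : enum 'I_3 = [:: 0; 1; 2%:R].
  by apply: (inj_map val_inj); rewrite val_enum_ord.
rewrite mem_sign_changes /signs_code E; case: c szc => [|x [|y [|z []]]] // _ /=.
split=> [|[e ->]]; last by case: ifP; case: ifP; case: ifP; rewrite /= !eqxx ?orbT.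
case: b => [|x' [|y' [|z' []]]] //=; rewrite ?andbF // andbT => /and3P[hx hy hz].
(* A block is flipped exactly where the two rows differ, so a zero row keeps its sign. *)
exists ([ffun i : 'I_3 => (nth false [:: x' != x; y' != y; z' != z] i)%:R] : signs).
rewrite !ffunE /=; congr [:: _; _; _].
- by case: eqP hx => //= _ /eqP.
- by case: eqP hy => //= _ /eqP.
- by case: eqP hz => //= _ /eqP.
Qed.

End Actions.

(** * Cliques of the orthogonality graph *)

Lemma orthC c d : orth c d = orth d c.
Proof.
rewrite /orth; congr (Z.eqb _ Z0).
have rowC x y : dot_row x y = dot_row y x.
  rewrite /dot_row; elim: x y => [|a x IH] [|b y] //=.
  by rewrite IH Z.mul_comm.
rewrite /dot_code; elim: c d => [|x c IH] [|y d] //=.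
by rewrite IH rowC.
Qed.

(* [common] is the set of the codes orthogonal to a clique, [later] the part of
   it that may still extend the clique, so that each clique is met only once;
   [b] tells whether the clique meets [P]. *)
Fixpoint saturates (P : pred code) (b : bool) (n : nat) (common later : seq code) :=
  if n is n'.+1 then
    (common != [::]) &&
    (fix walk l := if l is c :: l' then
       saturates P (b || P c) n' (filter (orth c) common) (filter (orth c) l')
       && walk l'
     else true) later
  else (common == [::]) && b.

(** [D] is what a maximal clique still has to add: the last hypothesis is its maximality inside
    [common]. Each level of the recursion consumes the first member of [D], and maximality is
    inherited by the codes orthogonal to it. *)
Lemma saturatesP P n b common later D :
  saturates P b n common later -> subseq D later -> pairwise orth D ->
  {subset later <= common} ->
  (forall c, c \in common -> has (fun d => ~~ orth c d) D) ->
  size D = n /\ (b || has P D).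
Proof.
elim: n b common later D => [|n IH] b common later D /=.
  case/andP=> /eqP -> ->; case: later => [|c l] hD _.
    by move: hD; rewrite subseq0 => /eqP ->.
  by move=> /(_ c (mem_head _ _)).
case/andP; case: common => [|c0 common] // _.
move: (c0 :: common) (mem_head c0 common) => {}common hc0.
(* An empty [D] is not maximal as long as [common] has an element. *)
case: D => [|d D] hw hD; first by move=> _ _ /(_ _ hc0).
rewrite pairwise_cons => /andP[dD pD] sub maxD.
(* The inner induction follows the walk until it reaches the first member of [D]. *)
elim: later hw hD sub => [|c l IHl] // /andP[hs hw]; rewrite [subseq _ _]/=.
case: eqP => [dc hD sub|_ hD sub]; last first.
  by apply: IHl => // x hx; apply: sub; rewrite inE hx orbT.
rewrite -{c}dc in hs sub; have [] := IH _ _ _ D hs.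
- by rewrite subseq_filter dD.
- exact: pD.
- by move=> x; rewrite !mem_filter => /andP[-> hx]; apply: sub; rewrite inE hx orbT.
- move=> x; rewrite mem_filter => /andP[dx /maxD] /=.
  by rewrite orthC dx.
by move=> /= -> ; rewrite orbA.
Qed.

(** The depth is 5 because [r] itself is the sixth member of the clique. *)
Definition saturates_at (P : pred code) (s : seq code) (r : code) : bool :=
  let s' := filter (orth r) s in saturates P (P r) 5 s' s'.

(** * Symmetries and maximal cliques of a configuration *)

Section Configurations.
Variable R : realType.
Local Notation vspaceM := {vspace 'M[R]_3}.
Local Notation orthL := (@orthogonal_lines R 'M[R]_3 (@dot9 R)).
Local Notation orthogonal_family := (@pairwise_orthogonal_lines R 'M[R]_3 (@dot9 R)).
Local Notation cline := (cline R).
Implicit Types (A U M P : set vspaceM) (L N : vspaceM).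

(** This abstracts from the group, so that wreath elements and arbitrary words transport cliques and
    colourings in the same way. *)
Record symmetry A (f g : vspaceM -> vspaceM) : Prop := Symmetry {
  symK : cancel f g;
  symKV : cancel g f;
  sym_stable : forall L, A L -> A (f L);
  sym_stableV : forall L, A L -> A (g L);
  sym_orth : forall L N, orthL L N -> orthL (f L) (f N);
  sym_orthV : forall L N, orthL L N -> orthL (g L) (g N) }.

Lemma symmetry_id A : symmetry A id id.
Proof. by split. Qed.

Lemma symmetry_comp A f g f' g' :
  symmetry A f g -> symmetry A f' g' -> symmetry A (f \o f') (g' \o g).
Proof.
case=> fK gK fA gA fo go [fK' gK' fA' gA' fo' go'].
split=> /=; try by [apply: can_comp | move=> L /fA'/fA | move=> L /gA/gA' |
  move=> L N /fo'/fo | move=> L N /go/go'].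
Qed.

(** Members of [M] also satisfy the last clause, with themselves as witness, when no line of [A] is
    orthogonal to itself. *)
Definition maxclique A M := [/\ M `<=` A, orthogonal_family M &
  forall L, A L -> exists2 N, M N & ~ orthL L N].

Lemma card_cline (D : seq code) : uniq D -> {in D &, injective cline} ->
  cline @` [set` D] #= `I_(size D).
Proof.
move=> uD injD.
have -> : cline @` [set` D] = (fun i => cline (nth [::] D i)) @` `I_(size D).
  apply/seteqP; split=> [_ [c hc <-]|_ [i hi <-]]; last first.
    by exists (nth [::] D i) => //=; exact: mem_nth.
  by exists (index c D); rewrite /= ?index_mem // nth_index.
apply: inj_card_eq => i j; rewrite !inE /= => hi hj /injD.
by rewrite !mem_nth // => /(_ isT isT)/eqP; rewrite nth_uniq // => /eqP.
Qed.

(** * Reduction to orbit representatives *)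

Section Homogeneous.
(** [P] is an invariant set of lines that every maximal clique has to meet, and [Pc] is a computable
    test for it. It is taken to be [O lambda4] for the smaller configuration and everything for the
    larger one. *)
Variables (A P : set vspaceM) (s reps : seq code) (Pc : pred code).
Hypothesis AE : A = cline @` [set` s].
Hypothesis ok_s : all code_ok s.
Hypothesis uniq_s : uniq s.
Hypothesis reps_s : all (mem s) reps.
Hypothesis sat_s : all (saturates_at Pc s) reps.
Hypothesis PcP : forall c, c \in s -> Pc c -> P (cline c).
Hypothesis trans : forall L, A L -> exists r f g,
  [/\ r \in reps, symmetry A f g, L = f (cline r) & forall L, P L -> P (f L)].

Lemma mem_cline c : c \in s -> A (cline c).
Proof. by move=> h; rewrite AE; exists c. Qed.

Lemma cline_s_inj : {in s &, injective cline}.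
Proof. by move=> c d hc hd; apply: cline_inj; exact: (allP ok_s). Qed.

Lemma orth_s c d : c \in s -> d \in s -> orthL (cline c) (cline d) <-> orth c d.
Proof.
move=> hc hd; apply: orth_clineP.
  by case/and4P: (allP ok_s _ hc).
by case/and4P: (allP ok_s _ hd).
Qed.

Lemma orth_irr L : A L -> ~ orthL L L.
Proof.
rewrite AE => -[c hc <-] /(orth_s hc hc).
by case/and4P: (allP ok_s _ hc) => _ _ _ /negP.
Qed.

(** Greedy extension: the codes are visited one by one, and a line is added whenever it is
    orthogonal to all lines chosen so far. *)
Lemma maxclique_ext U : U `<=` A -> orthogonal_family U ->
  exists2 M, U `<=` M & maxclique A M.
Proof.
move=> UA Uo.
suff [M [UM MA Mo maxM]] : exists M, [/\ U `<=` M, M `<=` A, orthogonal_family M &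
    forall c, c \in s -> exists2 N, M N & ~ orthL (cline c) N].
  by exists M => //; split=> // L; rewrite AE => -[c hc <-]; exact: maxM.
(* The induction runs over lists of codes contained in [s]; maximality is claimed only for the codes
   already visited. *)
elim: {-2}s (fun c (h : c \in s) => h) => [|c l IH] sub.
  by exists U; split.
have [|M [UM MA Mo maxM]] := IH.
  by move=> d hd; apply: sub; rewrite inE hd orbT.
have cA : A (cline c) by apply: mem_cline; apply: sub; rewrite mem_head.
have [ort|nort] := pselect (forall N, M N -> orthL (cline c) N); last first.
  exists M; split=> // d; rewrite inE => /orP[/eqP ->|/maxM //].
  by move/existsNP: nort => [N /not_implyP[]]; exists N.
exists (M `|` [set cline c]); split.
- by move=> N /UM; left.
- by move=> N [/MA|->].
- move=> N N' [hN|->] [hN'|->] // hNN; try exact: Mo.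
    exact/orth_sym/ort.
  exact: ort.
- move=> d; rewrite inE => /orP[/eqP ->|/maxM[N hN nN]].
    by exists (cline c); [right | exact: orth_irr].
  by exists N => //; left.
Qed.

Lemma maxclique_rep r M : r \in reps -> maxclique A M -> M (cline r) ->
  M #= `I_6 /\ (exists2 L, M L & P L).
Proof.
move=> hr [MA Mo maxM] Mr; have rs : r \in s by exact: (allP reps_s).
pose s' := filter (orth r) s.
(* The members of [M] other than the representative, in the order of [s'], form a subsequence, as
   [saturatesP] requires. *)
pose D := [seq c <- s' | `[< M (cline c) >]].
have sub : {subset D <= s} by move=> c; rewrite !mem_filter => /and3P[].
have uD : uniq D by rewrite !filter_uniq.
have oD : pairwise orth D.
  have := uD; rewrite uniq_pairwise.
  apply: (@sub_in_pairwise _ (mem D)) => [c d hc hd /= ncd|]; last exact/allP.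
  apply/orth_s; [exact: sub | exact: sub |].
  have {hc hd} : c \in D /\ d \in D by [].
  rewrite !mem_filter => -[] /and3P[/asboolP Mc _ cs] /and3P[/asboolP Md _ ds].
  by apply: Mo => // /cline_s_inj e; rewrite e ?eqxx in ncd.
have ME : M = cline @` [set` r :: D].
  apply/seteqP; split=> [L ML|_ [c /= + <-]]; last first.
    by rewrite inE => /orP[/eqP -> //|]; rewrite mem_filter => /andP[/asboolP].
  have := MA _ ML; rewrite {1}AE => -[c hc cL]; exists c => //=.
  rewrite inE; case: eqP => //= cr; rewrite !mem_filter hc andbT.
  apply/andP; split; first by apply/asboolP; rewrite cL.
  apply/orth_s => //; apply: Mo => //; first by rewrite cL.
  by move=> /cline_s_inj e; apply: cr; rewrite e.
have [||c|sz hP] := saturatesP (allP sat_s r hr) _ oD; last 1 first.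
- have urD : uniq (r :: D).
    rewrite /= uD andbT; apply/negP => /[!mem_filter]/and3P[_ orr _].
    by case/and4P: (allP ok_s _ rs); rewrite orr.
  have subr : {subset r :: D <= s}.
    by move=> c; rewrite inE => /orP[/eqP -> //|/sub].
  split.
    rewrite ME; have := card_cline urD; rewrite /= sz; apply.
    by move=> c d /subr hc /subr hd; exact: cline_s_inj.
  have : has Pc (r :: D) by [].
  case/hasP=> c hc Pcc; exists (cline c); first by rewrite ME; exists c.
  by apply: PcP => //; exact: subr.
- exact: filter_subseq.
- by [].
rewrite mem_filter => /andP[rc cs].
(* The witness [N] cannot be the representative, to which [c] is orthogonal; hence it comes from
   [D]. *)
have [N MN nN] := maxM _ (mem_cline cs).
move: MN; rewrite ME => -[d /= + dN]; rewrite inE => /orP[/eqP dr|dD].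
  by case: nN; rewrite -dN dr; apply/orth_s => //; rewrite orthC.
apply/hasP; exists d => //; apply/negP => od; apply: nN; rewrite -dN.
by apply/orth_s => //; exact: sub.
Qed.

(** A symmetry moves some member of [M] to a representative; the preimage of [M] is again a maximal
    clique, to which [maxclique_rep] applies. *)
Lemma maxclique_card M : A !=set0 -> maxclique A M ->
  M #= `I_6 /\ (exists2 L, M L & P L).
Proof.
move=> [L0 AL0] maxM; case: (maxM) => MA Mo hM.
(* [M] is nonempty, since by maximality some member fails to be orthogonal to [L0]. *)
have [L ML _] := hM _ AL0.
have [r [f [g [hr sf LE Pf]]]] := trans (MA _ ML).
have [||cM [N MN PN]] := @maxclique_rep r (f @^-1` M) hr.
- split=> [N /MA /(sym_stableV sf)|N N' hN hN' nN|N AN].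
  + by rewrite (symK sf).
  + rewrite -[N](symK sf) -[N'](symK sf); apply: (sym_orthV sf); apply: Mo => //.
    by move=> /(can_inj (symK sf)).
  + have [N' MN' nN'] := hM _ (sym_stable sf AN); exists (g N') => /=.
      by rewrite (symKV sf).
    by move=> /(sym_orth sf); rewrite (symKV sf).
- by rewrite /preimage /= -LE.
split; last by exists (f N); [exact: MN | exact: Pf].
have -> : M = f @` (f @^-1` M).
  apply/seteqP; split=> [N' MN'|_ [N' MN' <-] //].
  by exists (g N') => /=; rewrite (symKV sf).
apply: card_eq_trans cM; apply: inj_card_eq => x y _ _.
exact: (can_inj (symK sf)).
Qed.

Lemma homogeneous_projective : projective_configuration (block_sum0 R) A.
Proof.
split; first by rewrite AE; exact/finite_image/finite_seq.
by move=> L; rewrite AE => -[c /(allP ok_s)/cline_projective h <-].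
Qed.

Lemma homogeneous_card : A #= `I_(size s).
Proof. by rewrite AE; apply: card_cline => //; exact: cline_s_inj. Qed.

Lemma homogeneous_saturated : A !=set0 -> saturated (@dot9 R) (block_sum0 R) A.
Proof.
move=> A0 U UA Uo; have [M UM mM] := maxclique_ext UA Uo.
have [cM _] := maxclique_card A0 mM; case: mM => MA Mo _.
by exists M; rewrite dim_block_sum0.
Qed.

(** [M] extends to a maximal clique, which also has six members and therefore equals [M]. *)
Lemma six_meets M : A !=set0 -> M `<=` A -> orthogonal_family M -> M #= `I_6 ->
  exists2 L, M L & P L.
Proof.
move=> A0 MA Mo cM; have [M' MM' mM'] := maxclique_ext MA Mo.
have [cM' [L ML PL]] := maxclique_card A0 mM'.
suff -> : M = M' by exists L.
have fM : finite_set M by apply/finite_setP; exists 6%N.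
have fM' : finite_set M' by apply/finite_setP; exists 6%N.
apply: (fset_set_inj fM fM'); apply/eqP; rewrite finmap.eqEfcard.
by rewrite (card_fset_set cM) (card_fset_set cM') leqnn andbT -fset_set_sub.
Qed.

End Homogeneous.
End Configurations.

(** * Bicolourings *)

(* [stack] lists sets of codes that remain to be excluded as sets of red lines.
   Each entry of [cert] is a basis (of indices in [s]), one of whose members
   has to be red; it splits the first set of [stack]. *)
Fixpoint refutes (s : seq code) (blue : pred code) (stack : seq (seq code))
    (cert : seq (seq nat)) : bool :=
  match cert, stack with
  | _, [::] => true
  | [::], _ => false
  | b :: cert', reds :: stack' =>
    let basis := map (nth [::] s) b in
    [&& size b == 6%N, uniq basis, all (fun i => i < size s)%N b, pairwise orth basis
      & refutes s blue
          ([seq c :: reds | c <- basis & ~~ (blue c || has (orth c) reds)] ++ stack')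
          cert']
  end.

Section Colourings.
Variable R : realType.
Local Notation vspaceM := {vspace 'M[R]_3}.
Local Notation orthL := (@orthogonal_lines R 'M[R]_3 (@dot9 R)).
Local Notation orthogonal_family := (@pairwise_orthogonal_lines R 'M[R]_3 (@dot9 R)).
Local Notation cline := (cline R).
Implicit Types (A U M P red : set vspaceM) (L N : vspaceM).

(** Good bicolourings in terms of the set of red lines, which restricts to subsets and pulls back
    along symmetries without dependent types. Uniqueness of the red line in a basis follows from the
    second clause. *)
Definition good_red A red :=
  (forall M, M `<=` A -> orthogonal_family M -> M #= `I_6 ->
     exists2 L, M L & red L) /\
  (forall L N, A L -> A N -> orthL L N -> red L -> ~ red N).

Lemma red_linesE A (v : A -> bool) (x : A) : red_lines v (val x) <-> v x = true.
Proof.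
by split=> [[y /= vy /val_inj <-] //|vx]; exists x.
Qed.

Lemma good_bicolouring_red A (v : A -> bool) :
  good_bicolouring (@dot9 R) (block_sum0 R) v -> good_red A (red_lines v).
Proof.
case=> basis edge; split=> [M MA Mo cM|L N AL AN oLN [x /= vx xL] [y /= vy yN]]; last first.
  by move: oLN vx; rewrite -xL -yN => /edge-> .
have fM : finite_set M by apply/finite_setP; exists 6%N.
(* Listing the six lines of [M] gives the indexed family that the definition of a good bicolouring
   asks for. *)
pose l : seq vspaceM := fset_set M.
have lM L : L \in l -> M L by rewrite in_fset_set // inE.
have szl : size l = \dim (block_sum0 R) by rewrite dim_block_sum0 -(card_fset_set cM).
have hx (i : 'I_(\dim (block_sum0 R))) : exists x : A, val x = nth 0%VS l i.
  have Ai : nth 0%VS l i \in A by rewrite inE; apply/MA/lM/mem_nth; rewrite szl.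
  by exists (SigSub Ai).
have [x xE] := fin_all_exists hx.
have [i j nij|i [vi _]] := basis x.
  rewrite !xE; apply: Mo; try by apply/lM/mem_nth; rewrite szl.
  by apply/eqP; rewrite nth_uniq ?szl // finmap.fset_uniq.
exists (val (x i)); first by rewrite xE; apply/lM/mem_nth; rewrite szl.
exact/red_linesE.
Qed.

Lemma good_red_bicolouring A red : (forall L, A L -> ~ orthL L L) ->
  good_red A red ->
  good_bicolouring (@dot9 R) (block_sum0 R) (fun x : A => `[< red (val x) >]).
Proof.
move=> irr [basis edge]; have inA (x : A) : A (val x) by apply: set_mem; exact: valP.
split=> [x xo|x y oxy /asboolP rx]; last first.
  by apply/asboolP => ry; exact: (edge (val y) (val x)).
(* Lines with different indices are orthogonal, and no line is orthogonal to itself. *)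
have injx : injective (fun i => val (x i)).
  move=> i j e; apply/eqP/negPn/negP => /xo.
  by rewrite (_ : val (x i) = val (x j)) //; exact/irr/inA.
have [|||_ [i _ <-] ri] := basis (range (fun i => val (x i))).
- by move=> _ [i _ <-].
- move=> _ _ [i _ <-] [j _ <-] nij; apply: xo.
  by apply/eqP => ij; rewrite ij in nij.
- rewrite -(dim_block_sum0 R); apply: card_eq_trans (card_esym card_II).
  by apply: inj_card_eq => i j _ _; exact: injx.
exists i; split; first exact/asboolP.
move=> j /asboolP rj; apply/eqP/negPn/negP => /xo o.
exact: (edge (val (x i)) (val (x j))).
Qed.

Lemma good_red_sub A B red : B `<=` A -> good_red A red -> good_red B red.
Proof.
move=> BA [basis edge]; split=> [M MB|L N /BA AL /BA AN]; last exact: edge.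
by apply: basis; exact: subset_trans BA.
Qed.

Lemma good_red_sym A red f g :
  symmetry A f g -> good_red A red -> good_red A (f @^-1` red).
Proof.
move=> sf [basis edge]; split=> [M MA Mo cM|L N /(sym_stable sf) AL /(sym_stable sf) AN].
  have [|||_ [L ML <-] rL] := basis (f @` M); last by exists L.
  - by move=> _ [L /MA/(sym_stable sf) AL <-].
  - move=> _ _ [L ML <-] [N MN <-] nLN; apply: (sym_orth sf); apply: Mo => //.
    by move=> e; apply: nLN; rewrite e.
  - apply: card_eq_trans cM; apply: inj_card_eq => x y _ _.
    exact: (can_inj (symK sf)).
by move=> /(sym_orth sf); exact: edge.
Qed.

Section Refutation.
Variables (A : set vspaceM) (s : seq code).
Hypothesis AE : A = cline @` [set` s].
Hypothesis ok_s : all code_ok s.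

(** Soundness for any certificate: a basis has a red member, and a branch is discarded only if this
    member is blue or orthogonal to a line already red. The surviving branch is excluded by
    induction. *)
Lemma refutesP (blue : pred code) red stack cert :
  good_red A red -> (forall c, c \in s -> blue c -> ~ red (cline c)) ->
  refutes s blue stack cert ->
  forall reds, reds \in stack -> {subset reds <= s} ->
  ~ (forall c, c \in reds -> red (cline c)).
Proof.
move=> [basis edge] hblue.
elim: cert stack => [|b cert IH] [|reds0 stack] //= /and5P[sz ub hb ob hr] reds.
rewrite inE => /orP[/eqP -> {reds}|hreds] sub hred; last first.
  by apply: (IH _ hr reds) => //; rewrite mem_cat hreds orbT.
set bs := map _ b in ub ob hr.
have bs_s : {subset bs <= s}.
  by move=> _ /mapP[i /(allP hb) hi ->]; exact: mem_nth.
have hA c : c \in s -> A (cline c) by move=> h; rewrite AE; exists c.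
have [|||_ [c /= hc <-] rc] := basis (cline @` [set` bs]).
- by move=> _ [c /bs_s/hA h <-].
- move=> _ _ [c /= hc <-] [d /= hd <-] ncd; apply/(orth_s R ok_s); [exact: bs_s..|].
  (* [pairwise] speaks of increasing indices only; symmetry of [orth] covers the other order. *)
  have : {in bs &, forall c d, c != d -> orth c d}.
    move/(pairwiseP [::]): ob => h c' d' hc' hd'.
    rewrite -(nth_index [::] hc') -(nth_index [::] hd').
    rewrite nth_uniq ?index_mem // neq_ltn => /orP[] lt.
      by apply: h; rewrite ?inE ?index_mem.
    by rewrite orthC; apply: h; rewrite ?inE ?index_mem.
  by apply=> //; apply/eqP => e; apply: ncd; rewrite e.
- have := @card_cline R bs ub; rewrite size_map (eqP sz); apply.
  by move=> c d /bs_s hc /bs_s hd; exact: (cline_s_inj ok_s).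
apply: (IH _ hr (c :: reds0)).
- rewrite mem_cat; apply/orP; left; apply/mapP; exists c => //.
  rewrite mem_filter hc andbT negb_or; apply/andP; split.
    by apply/negP => /(hblue _ (bs_s _ hc)).
  apply/hasPn => d hd; apply/negP => ocd.
  apply: (edge (cline c) (cline d)) => //; try exact: hA (bs_s _ hc).
  + exact: hA (sub _ hd).
  + by apply/(orth_s R ok_s) => //; [exact: bs_s | exact: sub].
  + exact: hred.
- by move=> d; rewrite inE => /orP[/eqP -> |/sub //]; exact: bs_s.
- by move=> d; rewrite inE => /orP[/eqP -> //|]; exact: hred.
Qed.

End Refutation.

Lemma lineE a0 a1 a2 b0 b1 b2 c0 c1 c2 :
  cline [:: [:: a0; a1; a2]; [:: b0; b1; b2]; [:: c0; c1; c2]] =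
  line (vec3 (Zreal R a0) (Zreal R a1) (Zreal R a2))
       (vec3 (Zreal R b0) (Zreal R b1) (Zreal R b2))
       (vec3 (Zreal R c0) (Zreal R c1) (Zreal R c2)).
Proof.
congr <[_]>%VS; apply/matrixP => i j; rewrite !mxE.
by case: i => [[|[|[|]]]] //= ?; rewrite mxE; case: j => [[|[|[|]]]].
Qed.

Lemma vec3_0 : vec3 0 0 0 = 0 :> 'rV[R]_3.
Proof. by apply/rowP => j; rewrite !mxE; case: j => [[|[|[|]]]]. Qed.

Let ZrealE := (Zreal0 R, vec3_0).

Lemma lambda1E : lambda1 = cline code1.
Proof. by rewrite /lambda1 lineE !ZrealE. Qed.
Lemma lambda2E : lambda2 = cline code2.
Proof. by rewrite /lambda2 lineE. Qed.
Lemma lambda3E : lambda3 = cline code3.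
Proof. by rewrite /lambda3 lineE !ZrealE. Qed.
Lemma lambda4E : lambda4 = cline code4.
Proof. by rewrite /lambda4 lineE !ZrealE. Qed.
Lemma lambda5E : lambda5 = cline code5.
Proof. by rewrite /lambda5 lineE. Qed.
Lemma lambda6E : lambda6 = cline code6.
Proof. by rewrite /lambda6 lineE !ZrealE. Qed.

End Colourings.

(** * Enumeration of the configurations *)

Definition zero_row : seq Z := [:: Z0; Z0; Z0].
Definition single_codes : seq code :=
  flatten [seq [:: [:: x; zero_row; zero_row]; [:: zero_row; x; zero_row]; [:: zero_row; zero_row; x]]
          | x <- single_rows].
Definition row_triples (l : seq (seq Z)) : seq code :=
  [seq x :: t | x <- l, t <- [seq [:: y; z] | y <- l, z <- l]].
Definition third_codes : seq code := row_triples third_rows.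

Lemma orbit12_E6 c : c \in orbit_code code1 ++ orbit_code code2 ->
  exists2 d, d \in single_codes ++ third_codes & c = normalise d.
Proof.
have : all (mem (map normalise (single_codes ++ third_codes)))
    (orbit_code code1 ++ orbit_code code2) by vm_compute.
(* Generalising the list prevents its evaluation during unification. *)
by move: (orbit_code code1 ++ _) => o /allP h /h/mapP.
Qed.

Lemma E6_orbit12 d : d \in single_codes ++ third_codes ->
  normalise d \in orbit_code code1 ++ orbit_code code2.
Proof.
have : all (fun d => normalise d \in orbit_code code1 ++ orbit_code code2)
    (single_codes ++ third_codes) by vm_compute.
by move: (_ ++ _) (_ ++ _) => e o /allP h /h.
Qed.

Lemma Atilde_codes_ok : all code_ok Atilde_codes.
Proof. by vm_compute. Qed.
Lemma Atilde_codes_uniq : uniq Atilde_codes.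
Proof. by vm_compute. Qed.
Lemma Atilde_codes_size : size Atilde_codes = 198%N.
Proof. by vm_compute. Qed.

Lemma Ahat_codes_ok : all code_ok Ahat_codes.
Proof. by vm_compute. Qed.
Lemma Ahat_codes_uniq : uniq Ahat_codes.
Proof. by vm_compute. Qed.
Lemma Ahat_codes_size : size Ahat_codes = 558%N.
Proof. by vm_compute. Qed.

(** The orbit lists contain normalised codes only, so the representatives are normalised as well. *)
Lemma reps_tilde_mem : all (mem Atilde_codes) (map normalise reps_tilde).
Proof. by vm_compute. Qed.

Lemma reps_hat_mem : all (mem Ahat_codes) (map normalise reps_hat).
Proof. by vm_compute. Qed.

(** The exhaustive clique search; it also checks that each maximal clique meets the orbit of
    [code4]. *)
Lemma Atilde_saturates :
  all (saturates_at (mem (orbit_code code4)) Atilde_codes) (map normalise reps_tilde).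
Proof. by vm_compute. Qed.

(** With [predT] the search tests the size of the maximal cliques alone. *)
Lemma Ahat_saturates : all (saturates_at predT Ahat_codes) (map normalise reps_hat).
Proof. by vm_compute. Qed.

Lemma orbit4_nonorth : {in orbit_code code4 &, forall c d, ~~ orth c d}.
Proof.
have : all (fun c => all (fun d => ~~ orth c d) (orbit_code code4)) (orbit_code code4).
  by vm_compute.
by move: (orbit_code code4) => o /allP h c d /h/allP h'; exact: h'.
Qed.

Lemma orth_code4_flip : orth code4_flip code4.
Proof. by []. Qed.

(* Found by computer search; the numbers are indices in [Atilde_codes]. *)
Definition cert2 : seq (seq nat) :=
  [:: [:: 30; 34; 78; 101; 119; 155]; [:: 2; 32; 55; 68; 103; 140];
      [:: 1; 3; 6; 29; 107; 137]; [:: 13; 25; 39; 110; 164; 189];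
      [:: 4; 11; 13; 15; 79; 110]; [:: 6; 14; 26; 29; 49; 95];
      [:: 12; 24; 39; 107; 137; 190]; [:: 5; 20; 21; 25; 77; 115];
      [:: 1; 10; 18; 29; 62; 100]; [:: 6; 29; 40; 49; 95; 191];
      [:: 13; 21; 55; 96; 143; 191]]%N.
Definition cert1 : seq (seq nat) := [:: [:: 13; 17; 23; 25; 105; 135]]%N.
Definition cert3 : seq (seq nat) := [:: [:: 10; 22; 36; 107; 143; 195]]%N.
Definition cert5 : seq (seq nat) := [:: [:: 6; 17; 20; 32; 41; 97]]%N.

(** [l] lists representatives of the orbits already known to be blue; the search starts from [c] as
    the only red line. *)
Definition refuted (l : seq code) (c : code) : Prop :=
  exists cert, refutes Atilde_codes (mem (flatten (map orbit_code l)))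
    [:: [:: normalise c]] cert.

Lemma code2_refuted : refuted [::] code2.
Proof. by exists cert2; vm_compute. Qed.
(** A single basis suffices here, as for [code3] and [code5]: each of its members is blue already or
    orthogonal to the representative. *)
Lemma code1_refuted : refuted [:: code2] code1.
Proof. by exists cert1; vm_compute. Qed.
Lemma code3_refuted : refuted [:: code1; code2] code3.
Proof. by exists cert3; vm_compute. Qed.
Lemma code5_refuted : refuted [:: code1; code2; code3] code5.
Proof. by exists cert5; vm_compute. Qed.

Lemma orbit_code_size c : size c = 3%N -> {in orbit_code c, forall d, size d = 3%N}.
Proof.
move=> sc d; rewrite mem_undup => /allpairsPdep[x [y [hx hy ->]]].
have -> : size (normalise y) = size y by rewrite /normalise; case: ifP; rewrite ?size_map.
move: hx hy; rewrite mem_permutations mem_row_perms all2E => /perm_size ->.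
by rewrite sc => /andP[/eqP ->].
Qed.

(* Unification and [done] would otherwise evaluate these enumerations. *)
Local Opaque orbit_code orbit_hat_code saturates_at refutes.

Lemma set_map (T U : eqType) (f : T -> U) (s : seq T) :
  [set` map f s] = f @` [set` s].
Proof.
by apply/seteqP; split=> [_ /mapP[x hx ->]|_ [x hx <-]]; [exists x|exact: map_f].
Qed.

(** * The two configurations as lists of codes *)

Section Main.
Variable R : realType.
Local Notation vspaceM := {vspace 'M[R]_3}.
Local Notation orthL := (@orthogonal_lines R 'M[R]_3 (@dot9 R)).
Local Notation cline := (cline R).
Local Notation At := (Atilde R).
Local Notation Ah := (Ahat R).

Lemma Ohat_cline c : shaped c -> Ohat (cline c) = cline @` [set` orbit_hat_code c].
Proof.
move=> sc; have szc : size c = 3%N by case/andP: sc => /eqP.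
rewrite OhatE; apply/seteqP; split=> [_ [[e g] _ /= <-]|_ [b /= + <-]].
  have : O (cline c) (wreath_act g (cline c)) by exists g.
  rewrite O_cline // => -[d /= hd <-]; rewrite signs_act_cline -cline_normalise.
  exists (normalise (signs_code e d)) => //=; rewrite mem_undup.
  apply/allpairsPdep; exists d, (signs_code e d); split=> //.
  by apply/(signs_code_changes _ (orbit_code_size szc hd)); exists e.
rewrite mem_undup => /allpairsPdep[d [y [hd hy ->]]].
move/(signs_code_changes _ (orbit_code_size szc hd)): hy => [e ->].
have : (cline @` [set` orbit_code c]) (cline d) by exists d.
rewrite -O_cline // => -[g _ gE]; exists (e, g) => //=.
by rewrite gE signs_act_cline cline_normalise.
Qed.

Lemma image_codes_cons (f : code -> seq code) c l :
  cline @` [set` flatten (map f (c :: l))] =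
  cline @` [set` f c] `|` cline @` [set` flatten (map f l)].
Proof.
rewrite -image_setU; congr (cline @` _); apply/seteqP; split=> d /=.
  by rewrite mem_cat => /orP[]; [left|right].
by rewrite mem_cat => -[->//|->]; rewrite orbT.
Qed.

Lemma image_codes_nil (f : code -> seq code) :
  cline @` [set` flatten (map f [::])] = set0.
Proof. by apply/seteqP; split=> L // [c]. Qed.

Lemma image_codes (f : code -> seq code) (l : seq code) :
  cline @` [set` flatten (map f l)] = foldr setU set0 [seq cline @` [set` f c] | c <- l].
Proof.
elim: l => [|c l /= <-]; first exact: image_codes_nil.
exact: image_codes_cons.
Qed.

Lemma foldr_setU5 (B1 B2 B3 B4 B5 : set vspaceM) :
  foldr setU set0 [:: B1; B2; B3; B4; B5] = B1 `|` B2 `|` B3 `|` B4 `|` B5.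
Proof. by rewrite /= setU0 !setUA. Qed.

Lemma foldr_setU6 (B1 B2 B3 B4 B5 B6 : set vspaceM) :
  foldr setU set0 [:: B1; B2; B3; B4; B5; B6] =
  B1 `|` B2 `|` B3 `|` B4 `|` B5 `|` B6.
Proof. by rewrite /= setU0 !setUA. Qed.

Lemma Atilde_cline : At = cline @` [set` Atilde_codes].
Proof.
rewrite /Atilde -foldr_setU5 /Atilde_codes image_codes; congr (foldr _ _ _).
rewrite lambda1E lambda2E lambda3E lambda4E lambda5E.
by congr [:: _; _; _; _; _]; apply: O_cline.
Qed.

Lemma Ahat_cline : Ah = cline @` [set` Ahat_codes].
Proof.
rewrite /Ahat -foldr_setU6 /Ahat_codes image_codes; congr (foldr _ _ _).
rewrite lambda1E lambda2E lambda3E lambda4E lambda5E lambda6E.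
by congr [:: _; _; _; _; _; _]; apply: Ohat_cline.
Qed.

Lemma orbit4_sub : {subset orbit_code code4 <= Atilde_codes}.
Proof.
move=> d h; apply/flattenP; exists (orbit_code code4); last exact: h.
by apply: (map_f orbit_code).
Qed.

Local Opaque Atilde_codes Ahat_codes.

(** * Invariance under the group actions *)

Lemma O_stable (L M : vspaceM) g : O L M -> O L (wreath_act g M).
Proof. by move=> [h _ <-]; rewrite wreath_actM; eexists. Qed.

Lemma Ohat_stable (L M : vspaceM) a : Ohat L M -> Ohat L (letter_act a M).
Proof. by move=> [w _ <-]; exists (a :: w). Qed.

Lemma Atilde_stable L g : At L -> At (wreath_act g L).
Proof.
by move=> [[[[]|]|]|] /(O_stable g) h; [do 4 left|do 3 left; right|do 2 left; right|left; right|right].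
Qed.

Lemma Ahat_stable L a : Ah L -> Ah (letter_act a L).
Proof.
by move=> [[[[[]|]|]|]|] /(Ohat_stable a) h;
  [do 5 left|do 4 left; right|do 3 left; right|do 2 left; right|left; right|right].
Qed.

Lemma Atilde_symmetry g :
  symmetry At (@wreath_act R g) (wreath_act (wreath_inv g)).
Proof.
split; [exact: wreath_actK|exact: wreath_actKV|..].
- by move=> L; exact: Atilde_stable.
- by move=> L; exact: Atilde_stable.
- by move=> L N; exact: orth_wreath.
- by move=> L N; exact: orth_wreath.
Qed.

Lemma Ahat_symmetry_wreath g :
  symmetry Ah (@wreath_act R g) (wreath_act (wreath_inv g)).
Proof.
split; [exact: wreath_actK|exact: wreath_actKV|..].
- by move=> L; exact: (Ahat_stable (inl g)).
- by move=> L; exact: (Ahat_stable (inl (wreath_inv g))).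
- by move=> L N; exact: orth_wreath.
- by move=> L N; exact: orth_wreath.
Qed.

Lemma Ahat_symmetry_signs e : symmetry Ah (@signs_act R e) (signs_act e).
Proof.
split; [exact: signs_actK|exact: signs_actK|..].
- by move=> L; exact: (Ahat_stable (inr e)).
- by move=> L; exact: (Ahat_stable (inr e)).
- by move=> L N; exact: orth_signs.
- by move=> L N; exact: orth_signs.
Qed.

(** The inverse map is composed from the inverses of the letters in reverse order. *)
Lemma Ahat_symmetry_word (w : seq (wreath + signs)) :
  exists f, symmetry Ah (fun L => foldr (@letter_act R) L w) f.
Proof.
elim: w => [|[g|e] w [f IH]] /=.
- by exists id; exact: symmetry_id.
- exists (f \o wreath_act (wreath_inv g)).
  exact: (symmetry_comp (Ahat_symmetry_wreath g) IH).
- exists (f \o signs_act e); exact: (symmetry_comp (Ahat_symmetry_signs e) IH).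
Qed.

Lemma Atilde_transitive L : At L -> exists r f g,
  [/\ r \in map normalise reps_tilde, symmetry At f g, L = f (cline r) &
      forall N, O lambda4 N -> O lambda4 (f N)].
Proof.
have H c M : c \in reps_tilde -> O (cline c) M -> exists r f g,
  [/\ r \in map normalise reps_tilde, symmetry At f g, M = f (cline r) &
      forall N, O lambda4 N -> O lambda4 (f N)].
  move=> hc [g _ <-]; exists (normalise c), (wreath_act g), (wreath_act (wreath_inv g)).
  split; [exact: map_f|exact: Atilde_symmetry|by rewrite cline_normalise|].
  by move=> N; exact: O_stable.
move=> [[[[]|]|]|].
- by rewrite lambda1E; apply: H.
- by rewrite lambda2E; apply: H.
- by rewrite lambda3E; apply: H.
- by rewrite {1}lambda4E; apply: H.
- by rewrite lambda5E; apply: H.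
Qed.

Lemma Ahat_transitive L : Ah L -> exists r f g,
  [/\ r \in map normalise reps_hat, symmetry Ah f g, L = f (cline r) &
      forall N, (setT : set vspaceM) N -> setT (f N)].
Proof.
have H c M : c \in reps_hat -> Ohat (cline c) M -> exists r f g,
  [/\ r \in map normalise reps_hat, symmetry Ah f g, M = f (cline r) &
      forall N, (setT : set vspaceM) N -> setT (f N)].
  move=> hc [w _ <-]; have [f sf] := Ahat_symmetry_word w.
  exists (normalise c), (fun L => foldr (@letter_act R) L w), f.
  by split=> //; [exact: map_f|rewrite cline_normalise].
move=> [[[[[]|]|]|]|].
- by rewrite lambda1E; apply: H.
- by rewrite lambda2E; apply: H.
- by rewrite lambda3E; apply: H.
- by rewrite lambda4E; apply: H.
- by rewrite lambda5E; apply: H.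
- by rewrite lambda6E; apply: H.
Qed.

Lemma Atilde_neq0 : At !=set0.
Proof. by exists lambda1; do 4 left; exists ([ffun=> 1%g], 1%g); rewrite // wreath_act_id. Qed.

Lemma Ahat_neq0 : Ah !=set0.
Proof. by exists lambda1; do 5 left; exists [::]. Qed.

Lemma O_sub_Ohat (L : vspaceM) : O L `<=` Ohat L.
Proof. by move=> _ [g _ <-]; exists [:: inl g]. Qed.

Lemma Atilde_sub : At `<=` Ah.
Proof.
move=> L [[[[]|]|]|] /O_sub_Ohat h; left;
  [do 4 left|do 3 left; right|do 2 left; right|left; right|right]; exact: h.
Qed.

Lemma A_sub : A_E6 R `<=` At.
Proof. by move=> L h; do 3 left. Qed.

(** * Saturation and good bicolourings *)

Lemma O_lambda4 : O lambda4 = cline @` [set` orbit_code code4].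
Proof. by rewrite lambda4E; apply: O_cline. Qed.

Lemma O4_codes c : c \in Atilde_codes -> c \in orbit_code code4 -> O lambda4 (cline c).
Proof. by move=> _ h; rewrite O_lambda4; exists c. Qed.

Lemma O4_nonorth (L N : vspaceM) : O lambda4 L -> O lambda4 N -> ~ orthL L N.
Proof.
rewrite O_lambda4 => -[c hc <-] [d hd <-].
move=> /(orth_s R Atilde_codes_ok (orbit4_sub hc) (orbit4_sub hd)) o.
by have := orbit4_nonorth hc hd; rewrite o.
Qed.

Lemma Atilde_saturated : saturated (@dot9 R) (block_sum0 R) At.
Proof.
exact: (homogeneous_saturated Atilde_cline Atilde_codes_ok Atilde_codes_uniq reps_tilde_mem
  Atilde_saturates O4_codes Atilde_transitive Atilde_neq0).
Qed.

Lemma Ahat_saturated : saturated (@dot9 R) (block_sum0 R) Ah.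
Proof.
exact: (@homogeneous_saturated _ _ setT _ _ _ Ahat_cline Ahat_codes_ok Ahat_codes_uniq reps_hat_mem
  Ahat_saturates (fun _ _ _ => I) Ahat_transitive Ahat_neq0).
Qed.

(** If the image of [c] under [g] were red, then [c] would be red in the pullback by [g], which is
    again good. So a certificate for the representative excludes its whole orbit; the blue orbits
    are assumed for every good red set in order to cover the pullback. *)
Lemma orbit_blue c (l : seq code) : c \in reps_tilde -> shaped c ->
  all shaped l -> (forall red, good_red At red ->
     forall b, b \in l -> O (cline b) `&` red = set0) ->
  refuted l c ->
  forall red, good_red At red -> O (cline c) `&` red = set0.
Proof.
move=> hc sc sl hblue rc red hred; apply/seteqP; split=> // L [[g _ <-] rL].
have hred' := good_red_sym (Atilde_symmetry g) hred.
case: rc => cert hcert.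
apply: (refutesP Atilde_cline Atilde_codes_ok hred' _ hcert (mem_head _ _)) => {hcert}.
- move=> d _ /flattenP[_ /mapP[b hb ->] hd] rd.
  have : (O (cline b) `&` (wreath_act g @^-1` red)) (cline d).
    by split=> //; rewrite O_cline; [exists d | exact: (allP sl)].
  by rewrite (hblue _ hred' _ hb).
- by move=> d; rewrite inE => /eqP ->; apply: (allP reps_tilde_mem); exact: map_f.
- by move=> d; rewrite inE => /eqP ->; rewrite cline_normalise.
Qed.

(** The orbits are excluded in the order 2, 1, 3, 5, since each certificate relies on the orbits
    treated before it. *)
Lemma red_sub_O4 red : good_red At red -> At `&` red `<=` O lambda4.
Proof.
have blue2 : forall r, good_red At r -> O (cline code2) `&` r = set0.
  by apply: (@orbit_blue code2 [::] isT isT isT _ code2_refuted).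
have blue1 : forall r, good_red At r -> O (cline code1) `&` r = set0.
  apply: (@orbit_blue code1 [:: code2] isT isT isT _ code1_refuted) => r hr b.
  by rewrite !inE => /eqP ->; exact: blue2.
have blue3 : forall r, good_red At r -> O (cline code3) `&` r = set0.
  apply: (@orbit_blue code3 [:: code1; code2] isT isT isT _ code3_refuted) => r hr b.
  by rewrite !inE => /orP[]/eqP ->; [exact: blue1|exact: blue2].
have blue5 : forall r, good_red At r -> O (cline code5) `&` r = set0.
  apply: (@orbit_blue code5 [:: code1; code2; code3] isT isT isT _ code5_refuted) => r hr b.
  by rewrite !inE => /or3P[]/eqP ->; [exact: blue1|exact: blue2|exact: blue3].
move=> hred L [[[[[]|]|]|] + rL] //.
- by rewrite lambda1E => h; move: (conj h rL : (_ `&` _) L); rewrite blue1.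
- by rewrite lambda2E => h; move: (conj h rL : (_ `&` _) L); rewrite blue2.
- by rewrite lambda3E => h; move: (conj h rL : (_ `&` _) L); rewrite blue3.
- by rewrite lambda5E => h; move: (conj h rL : (_ `&` _) L); rewrite blue5.
Qed.

Lemma O4_sub : O lambda4 `<=` At.
Proof. by move=> L h; left; right. Qed.

(** For the converse inclusion, a line of [O lambda4] is extended to a basis. The red member of this
    basis lies in [O lambda4] too, hence coincides with the given line because no two lines of that
    orbit are orthogonal. *)
Lemma red_O4 red : good_red At red -> At `&` red = O lambda4.
Proof.
move=> hred; apply/seteqP; split=> [|L hL]; first exact: red_sub_O4.
split; first exact: O4_sub.
have [||M UM mM] := @maxclique_ext _ _ _ Atilde_cline Atilde_codes_ok [set L].
- by move=> _ ->; exact: O4_sub.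
- by move=> _ _ -> ->.
have [cM _] := maxclique_card Atilde_cline Atilde_codes_ok Atilde_codes_uniq reps_tilde_mem
  Atilde_saturates O4_codes Atilde_transitive Atilde_neq0 mM.
case: mM => MA Mo _; have [N MN rN] := hred.1 M MA Mo cM.
have ON : O lambda4 N by apply: (red_sub_O4 hred); split=> //; exact: MA.
have [-> //|nLN] := pselect (L = N).
by case: (O4_nonorth hL ON); apply: Mo => //; exact: UM.
Qed.

Lemma O4_good : good_red At (O lambda4).
Proof.
split=> [M MA Mo cM|L N _ _ oLN OL ON]; last exact: O4_nonorth oLN.
exact: (six_meets Atilde_cline Atilde_codes_ok Atilde_codes_uniq reps_tilde_mem
  Atilde_saturates O4_codes Atilde_transitive Atilde_neq0 MA Mo cM).
Qed.

Lemma red_lines_At (v : At -> bool) :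
  good_bicolouring (@dot9 R) (block_sum0 R) v -> red_lines v = O lambda4.
Proof.
move=> /good_bicolouring_red/red_O4 <-; apply/seteqP; split=> [L hL|L [] //].
by split=> //; case: hL => x _ <-; apply: set_mem; exact: valP.
Qed.

Lemma Atilde_colouring :
  exists! v : At -> bool, good_bicolouring (@dot9 R) (block_sum0 R) v.
Proof.
exists (fun x => `[< O lambda4 (val x) >]); split.
  exact: (good_red_bicolouring (orth_irr Atilde_cline Atilde_codes_ok) O4_good).
(* A bicolouring is determined by its red lines. *)
move=> v hv; apply/funext => x; apply/asboolP/idP.
  by rewrite -(red_lines_At hv) => /red_linesE.
by rewrite -(red_lines_At hv) => /red_linesE.
Qed.

Lemma Ahat_noncolourable : ~ colourable (@dot9 R) (block_sum0 R) Ah.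
Proof.
move=> [v /good_bicolouring_red hred]; move: (red_lines v) hred => red hred.
(* This sign change flips the first block only. *)
pose e : signs := [ffun i => (i == 0)%:R].
have h4 : O lambda4 (@lambda4 R) by exists ([ffun=> 1%g], 1%g); rewrite // wreath_act_id.
have r4 f : good_red Ah f -> f lambda4.
  by move=> /(good_red_sub Atilde_sub)/red_O4 E; move: h4; rewrite -E => -[].
have A4 : Ah lambda4 by apply/Atilde_sub/O4_sub.
apply: (hred.2 (signs_act e lambda4) lambda4) => //.
- exact: (Ahat_stable (inr e)).
- have -> : signs_act e lambda4 = cline code4_flip.
    rewrite lambda4E signs_act_cline /signs_code (_ : enum 'I_3 = [:: 0; 1; 2%:R]) /= ?ffunE //.
    by apply: (inj_map val_inj); rewrite val_enum_ord.
  by rewrite lambda4E; apply/orth_clineP => //; exact: orth_code4_flip.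
(* The pullback of [red] by the sign change contains [lambda4], which says that the flipped line is
   red. *)
- exact: (r4 _ (good_red_sym (Ahat_symmetry_signs e) hred)).
- exact: r4.
Qed.

(** * Identification with the lines of the $E_6$ roots *)

Definition vecZ (x : seq Z) : 'rV[R]_3 := \row_j Zreal R (nth Z0 x j).

Lemma code_mx_blocks x y z : code_mx R [:: x; y; z] = blocks (vecZ x) (vecZ y) (vecZ z).
Proof.
by apply/matrixP => i j; rewrite !mxE; case: i => [[|[|[|]]]] //= ?; rewrite mxE.
Qed.

Lemma vecZ3 a b c : vecZ [:: a; b; c] = vec3 (Zreal R a) (Zreal R b) (Zreal R c).
Proof. by apply/rowP => j; rewrite !mxE; case: j => [[|[|[|]]]]. Qed.

Lemma vecZ0 : vecZ zero_row = 0.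
Proof. by apply/rowP => j; rewrite !mxE; case: j => [[|[|[|]]]]. Qed.

Lemma E6_singleE : @E6_single R = vecZ @` [set` single_rows].
Proof.
have E : map vecZ single_rows = [:: vec3 1 (-1) 0; vec3 1 0 (-1); vec3 0 1 (-1)].
  by rewrite /= !vecZ3.
by rewrite /E6_single -E set_map.
Qed.

Lemma E6_thirdE : @E6_third R = (fun x => 3^-1 *: vecZ x) @` [set` third_rows].
Proof.
have E : map (fun x => 3^-1 *: vecZ x) third_rows =
  [:: 3^-1 *: vec3 2 (-1) (-1); 3^-1 *: vec3 (-1) 2 (-1); 3^-1 *: vec3 (-1) (-1) 2].
  by rewrite /= !vecZ3.
by rewrite /E6_third -E set_map.
Qed.

Lemma blocksZ (k : R) x y z : blocks (k *: x) (k *: y) (k *: z) = k *: blocks x y z.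
Proof.
by apply/matrixP => i j; rewrite !mxE; case: i => [[|[|[|]]]] //= ?; rewrite mxE.
Qed.

Lemma mem_single_codes c : c \in single_codes <-> exists2 x, x \in single_rows &
  [\/ c = [:: x; zero_row; zero_row], c = [:: zero_row; x; zero_row] | c = [:: zero_row; zero_row; x]].
Proof.
split=> [/flattenP[_ /mapP[x hx ->]]|[x hx h]].
  by rewrite !inE => /or3P[]/eqP ->; exists x => //; [constructor 1|constructor 2|constructor 3].
apply/flattenP; exists [:: [:: x; zero_row; zero_row]; [:: zero_row; x; zero_row]; [:: zero_row; zero_row; x]].
  by apply/mapP; exists x.
by case: h => ->; rewrite !inE eqxx ?orbT.
Qed.

Lemma mem_row_triples l c : c \in row_triples l <-> exists x y z,
  [/\ x \in l, y \in l, z \in l & c = [:: x; y; z]].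
Proof.
split=> [/allpairsP[[x t] /= [hx /allpairsP[[y z] /= [hy hz ->]] ->]]|].
  by exists x, y, z.
move=> [x [y [z [hx hy hz ->]]]]; apply/allpairsP; exists (x, [:: y; z]).
by split=> //; apply/allpairsP; exists (y, z).
Qed.

(** The factor $1/3$ is common to the three blocks, so it scales the whole vector and leaves its
    line unchanged. *)
Lemma E6_half_line L : (exists2 u, E6_half u & <[u]>%VS = L) <->
  (exists2 c, c \in single_codes ++ third_codes & cline c = L).
Proof.
have k0 : 3^-1 != 0 :> R by rewrite invr_neq0 // pnatr_eq0.
split=> [[u [[xi]|[xi [eta [zeta []]]]]]|[c]].
- rewrite E6_singleE => -[x hx <-] h <-.
  suff [c hc ->] : exists2 c, c \in single_codes & u = code_mx R c.
    by exists c; [rewrite mem_cat hc|].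
  case: h => ->; rewrite -vecZ0 -code_mx_blocks; eexists; try reflexivity;
    apply/mem_single_codes; exists x => //;
    by [constructor 1|constructor 2|constructor 3].
- rewrite E6_thirdE => -[x hx <-] [y hy <-] [z hz <-] -> <-.
  exists [:: x; y; z]; last by rewrite blocksZ vline_scale // -code_mx_blocks.
  by rewrite mem_cat; apply/orP; right; apply/mem_row_triples; exists x, y, z.
- rewrite mem_cat => /orP[/mem_single_codes[x hx hc]|/mem_row_triples[x [y [z [hx hy hz ->]]]]] <-.
    exists (code_mx R c) => //; left; exists (vecZ x); first by rewrite E6_singleE; exists x.
    by case: hc => ->; rewrite code_mx_blocks !vecZ0;
      [constructor 1|constructor 2|constructor 3].
  exists (3^-1 *: code_mx R [:: x; y; z]); last exact: vline_scale.
  right; exists (3^-1 *: vecZ x), (3^-1 *: vecZ y), (3^-1 *: vecZ z).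
  by rewrite E6_thirdE; split; [exists x|exists y|exists z|rewrite blocksZ code_mx_blocks].
Qed.

Lemma E6_configurationE : A_E6 R = E6_configuration R.
Proof.
(* Opposite roots span the same line, so half of the roots suffice. *)
have -> : E6_configuration R = [set L | exists2 u, E6_half u & <[u]>%VS = L].
  apply/seteqP; split=> [L [u [hu|hu] <-]|L [u hu uL]].
  - by exists u.
  - by exists (- u); rewrite // -scaleN1r vline_scale // oppr_eq0 oner_eq0.
  - by exists u => //; left.
rewrite /A_E6 lambda1E lambda2E !O_cline //.
apply/seteqP; split=> L.
  move=> hL; have [c hc <-] : exists2 c, c \in orbit_code code1 ++ orbit_code code2 & cline c = L.
    case: hL => -[c hc <-]; exists c; try reflexivity; rewrite mem_cat; apply/orP.
      by left; exact: hc.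
    by right; exact: hc.
  apply/E6_half_line; have [d hd ->] := orbit12_E6 hc.
  by exists d => //; rewrite cline_normalise.
move=> /E6_half_line[d hd <-]; have := E6_orbit12 hd.
by rewrite mem_cat -cline_normalise => /orP[] h; [left|right]; exists (normalise d).
Qed.

End Main.

Theorem theorem2 (R : realType) :
  let dot := @dot9 R in
  let H := block_sum0 R in
  let A := A_E6 R in
  let At := Atilde R in
  let Ah := Ahat R in
  [/\ A = E6_configuration R,
      [/\ projective_configuration H At,
          saturated dot H At,
          A `<=` At,
          At #= `I_198
        & (exists! v : At -> bool, good_bicolouring dot H v) /\
          (forall v : At -> bool,
             good_bicolouring dot H v -> red_lines v = O lambda4)]
    & [/\ projective_configuration H Ah,
          saturated dot H Ah,
          ~ colourable dot H Ah,
          A `<=` At /\ At `<=` Ah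
        & Ah #= `I_558]].
Proof.
move=> dot H A At Ah; split; first exact: E6_configurationE.
  split; last by split; [exact: Atilde_colouring | exact: red_lines_At].
  - exact: (homogeneous_projective (@Atilde_cline R) Atilde_codes_ok).
  - exact: Atilde_saturated.
  - exact: A_sub.
  - by have := homogeneous_card (@Atilde_cline R) Atilde_codes_ok Atilde_codes_uniq; rewrite Atilde_codes_size.
split.
- exact: (homogeneous_projective (@Ahat_cline R) Ahat_codes_ok).
- exact: Ahat_saturated.
- exact: Ahat_noncolourable.
- by split; [exact: A_sub | exact: Atilde_sub].
- by have := homogeneous_card (@Ahat_cline R) Ahat_codes_ok Ahat_codes_uniq; rewrite Ahat_codes_size.
Qed.
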